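(* Let $\phi$ be a stable almost flow and $\zeta$ an almost flow on the Banach space $V$ over $[0,T]$ (with respect to the same $\omega,\varpi$). Let $y,z:[0,T]\to V$ be two paths such that, for a constant $K$, $$|y_t-\phi_{t,s}(y_s)|\le K\varpi(\omega_{s,t})\quad\text{and}\quad|z_t-\zeta_{t,s}(z_s)|\le K\varpi(\omega_{s,t}),\qquad 0\le s\le t\le T.$$ Write $\alpha_{t,s}:=\zeta_{t,s}-\phi_{t,s}$ and $\alpha_{t,s,r}:=\zeta_{t,s,r}-\phi_{t,s,r}$. Let $\epsilon_1,\epsilon_2,\epsilon_3>0$ be such that for any $0\le r\le s\le t\le T$, $$|\alpha_{t,s,r}(z_r)|\le\epsilon_1\varpi(\omega_{r,t}),\qquad\|\alpha_{t,s}\|_{\mathrm{Lip}}\le\epsilon_2\qquad\text{and}\qquad|\alpha_{t,s}(z_s)|\le\epsilon_3 .$$ Then there exist a time $T$ small enough and a constant $C$ that depends only on $\phi$, $K$, $T\mapsto\delta_T$, $\varkappa$ and $\sup_{r\le s\le t}\|\phi_{t,s,r}\|_{\mathrm{Lip}}/\varpi(\omega_{r,t})$ such that for all $0\le s\le t\le T$, $$|y_t-z_t|\le C(\epsilon_1+\epsilon_2+\epsilon_3+|y_0-z_0|)$$ and $$|y_t-\phi_{t,s}(y_s)-z_t+\zeta_{t,s}(z_s)|\le C(\epsilon_1+\epsilon_2+\epsilon_3+|y_0-z_0|)\,\varpi(\omega_{s,t}).$$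
   Context: Setting. $(V,|\cdot|)$ is a Banach space and $T>0$ a time horizon. For $f:V\to V$, $\|f\|_\infty=\sup_a|f(a)|$ and $\|f\|_{\mathrm{Lip}}=\sup_{a\ne b}|f(a)-f(b)|/|a-b|$. A control $\omega$ is a family of numbers $\omega_{s,t}\ge0$, $0\le s\le t\le T$, which is super-additive ($\omega_{r,s}+\omega_{s,t}\le\omega_{r,t}$ for $r\le s\le t$), continuous near the diagonal, with $\omega_{s,s}=0$. A remainder $\varpi:[0,\omega_{0,T}]\to\mathbb R_+$ is a continuous increasing function such that for some $0<\varkappa<1$, $2\varpi(\tau/2)\le\varkappa\varpi(\tau)$ for $\tau>0$. $\delta:\mathbb R_+\to\mathbb R_+$, $T'\mapsto\delta_{T'}$, is non-decreasing with $\lim_{T'\to0}\delta_{T'}=0$. Fix $\gamma\in(0,1]$ and a continuous increasing $\eta:[0,\omega_{0,T}]\to\mathbb R_+$ with $\eta(\omega_{s,t})\varpi(\omega_{s,t})^\gamma\le\delta_{T'}\varpi(\omega_{s,t})$ for $0\le s\le t\le T'\le T$. ''There exist a time $T$ small enough'' means that the conclusion holds on $[0,T_0]$ in place of $[0,T]$ for some sufficiently small $T_0\in(0,T]$. For a family of maps $\phi_{t,s}:V\to V$, $\phi_{t,s,r}:=\phi_{t,s}\circ\phi_{s,r}-\phi_{t,r}$ for $r\le s\le t$ (likewise $\zeta_{t,s,r}$). Almost flow. A family of continuous maps $\phi_{t,s}:V\to V$, $0\le s\le t\le T$, such that for a constant $M\ge0$, every $T'\in(0,T]$, all $0\le r\le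 s\le t\le T'$ and $a,b\in V$: $\phi_{t,t}=\mathrm{id}$; $\|\phi_{t,s}-\mathrm{id}\|_\infty\le\delta_{T'}$; $|\phi_{t,s}(b)-\phi_{t,s}(a)|\le(1+\delta_{T'})|b-a|+\eta(\omega_{s,t})|b-a|^\gamma$; $\|\phi_{t,s,r}\|_\infty\le M\varpi(\omega_{r,t})$. 4-points control. A function $f:V\to V$ satisfies a 4-points control if there are a non-decreasing continuous function $\widehat f:\mathbb R_+\to\mathbb R_+$ and a constant $f^\dagger\ge0$ such that for all $a,b,c,d\in V$, $$|f(a)-f(b)-f(c)+f(d)|\le\widehat f(|a-b|\vee|c-d|)\,(|a-c|\vee|b-d|)+f^\dagger|a-b-c+d|.$$ Stable almost flow. An almost flow with the Lipschitz bound $\|\phi_{t,s}\|_{\mathrm{Lip}}\le1+\delta_{T'}$ for $0\le s\le t\le T'$ (case $\gamma=1$), such that: each $\phi_{t,s}$, $0\le s\le t\le T'$, satisfies a 4-points control with some $\widehat\phi_{t,s}$ and $\phi^\dagger_{t,s}\le1+\delta_{T'}$; $\widehat\phi_{t,s}\le\widehat\phi_{v,u}$ whenever $[s,t]\subset[u,v]$; $\widehat\phi_{t,s}(\alpha\varpi(\omega_{s,t}))\le\phi^{\circledast}(\alpha)\varpi(\omega_{s,t})$ for all $\alpha\ge0$, with $\phi^\circledast:\mathbb R_+\to\mathbb R_+$ not depending on $(s,t)$; and $\|\phi_{t,s,r}\|_{\mathrm{Lip}}\le C'\varpi(\omega_{r,t})$ for all $r\le s\le t$ and some constant $C'$. 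*)

(* Defs.v *)
From HB Require Import structures.
From mathcomp Require Import all_boot all_order all_algebra.
From mathcomp Require Import all_classical all_reals all_analysis.
Set Implicit Arguments.
Unset Strict Implicit.
Unset Printing Implicit Defensive.
Import Order.TTheory GRing.Theory Num.Theory.
Import numFieldNormedType.Exports.
Local Open Scope classical_set_scope.
Local Open Scope ring_scope.

(* Two-parameter objects on the simplex 0 <= s <= t <= T are total functions
   constrained only there; omega_{s,t} is [omega s t] and phi_{t,s} is
   [phi t s]. *)

Section norms.
Variables (R : realType) (V : normedModType R).

Definition sup_norm (f : V -> V) : \bar R :=
  ereal_sup [set `|f a|%:E | a in [set: V]].

(* This is -oo when V is trivial, which satisfies the same upper bounds
   by nonnegative reals as the usual value 0. *)
Definition lip_norm (f : V -> V) : \bar R :=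
  ereal_sup [set (`|f p.1 - f p.2| / `|p.1 - p.2|)%:E
            | p in [set p : V * V | p.1 != p.2]].

End norms.

Section setting.
Variable R : realType.

Definition simplex (T : R) : set (R * R) :=
  [set p | 0 <= p.1 /\ p.1 <= p.2 /\ p.2 <= T].

(* Continuity near the diagonal is required at the points of the diagonal
   only. *)
Record control (T : R) (omega : R -> R -> R) : Prop := {
  control_ge0 : forall s t, 0 <= s -> s <= t -> t <= T -> 0 <= omega s t;
  control_superadd : forall r s t, 0 <= r -> r <= s -> s <= t -> t <= T ->
    omega r s + omega s t <= omega r t;
  control_diag : forall s, 0 <= s -> s <= T -> omega s s = 0;
  control_cont : forall u, 0 <= u -> u <= T ->
    omega p.1 p.2 @[p --> within (simplex T) (nbhs (u, u))] --> omega u u }.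

(* [Omega] stands for omega_{0,T}.  The clause varpi 0 = 0 follows from the
   others when 0 < Omega, by letting tau tend to 0; it only matters when the
   domain [0, Omega] is reduced to a point. *)
Record remainder (Omega varkappa : R) (varpi : R -> R) : Prop := {
  remainder_varkappa : 0 < varkappa < 1;
  remainder_ge0 : {in `[0, Omega], forall tau, 0 <= varpi tau};
  remainder_cont : {within `[0, Omega], continuous varpi};
  remainder_incr : {in `[0, Omega] &, {homo varpi : x y / x <= y}};
  remainder0 : varpi 0 = 0;
  remainder_half : forall tau, 0 < tau -> tau <= Omega ->
    2 * varpi (tau / 2) <= varkappa * varpi tau }.

Record time_modulus (delta : R -> R) : Prop := {
  time_modulus_ge0 : forall x, 0 <= x -> 0 <= delta x;
  time_modulus_ndecr : {in `[0, +oo[ &, {homo delta : x y / x <= y}};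
  time_modulus_lim : delta x @[x --> 0^'+] --> (0 : R) }.

Record holder_term (T : R) (omega : R -> R -> R) (varpi delta : R -> R)
    (gamma : R) (eta : R -> R) : Prop := {
  holder_gamma : 0 < gamma <= 1;
  holder_ge0 : {in `[0, omega 0 T], forall tau, 0 <= eta tau};
  holder_cont : {within `[0, omega 0 T], continuous eta};
  holder_incr : {in `[0, omega 0 T] &, {homo eta : x y / x <= y}};
  holder_le : forall T' s t, 0 <= s -> s <= t -> t <= T' -> T' <= T ->
    eta (omega s t) * varpi (omega s t) `^ gamma
      <= delta T' * varpi (omega s t) }.

Definition four_points_control (V : normedModType R)
    (f : V -> V) (fhat : R -> R) (fdag : R) : Prop :=
  [/\ {in `[0, +oo[, forall x, 0 <= fhat x},
      {in `[0, +oo[ &, {homo fhat : x y / x <= y}},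
      {within `[0, +oo[, continuous fhat},
      0 <= fdag
    & forall a b c d : V,
        `|f a - f b - f c + f d|
          <= fhat (Num.max `|a - b| `|c - d|) * Num.max `|a - c| `|b - d|
             + fdag * `|a - b - c + d| ].

Variable V : completeNormedModType R.
Implicit Types phi : R -> R -> V -> V.

(* phi_{t,s,r} *)
Definition defect phi (t s r : R) (a : V) : V :=
  phi t s (phi s r a) - phi t r a.

Record almost_flow (T : R) (omega : R -> R -> R) (varpi delta : R -> R)
    (gamma : R) (eta : R -> R) phi : Prop := {
  almost_flow_cont : forall s t, 0 <= s -> s <= t -> t <= T ->
    continuous (phi t s);
  almost_flow_diag : forall t, 0 <= t -> t <= T -> phi t t = id;
  almost_flow_near_id : forall T', 0 < T' -> T' <= T ->
    forall s t, 0 <= s -> s <= t -> t <= T' ->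
    (sup_norm (fun a => phi t s a - a)%R <= (delta T')%:E)%E;
  almost_flow_holder : forall T', 0 < T' -> T' <= T ->
    forall s t, 0 <= s -> s <= t -> t <= T' ->
    forall a b : V, `|phi t s b - phi t s a|
      <= (1 + delta T') * `|b - a| + eta (omega s t) * `|b - a| `^ gamma;
  almost_flow_defect : exists2 M : R, 0 <= M &
    forall r s t, 0 <= r -> r <= s -> s <= t -> t <= T ->
    (sup_norm (defect phi t s r) <= (M * varpi (omega r t))%:E)%E }.

(* The growth function [phistar] and the constant [C'], which bounds
   ||phi_{t,s,r}||_Lip / varpi(omega_{r,t}), are parameters so that the
   dependence of other constants on them can be expressed. *)
Record stable_almost_flow (T : R) (omega : R -> R -> R)
    (varpi delta eta phistar : R -> R) (C' : R) phi : Prop := {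
  stable_almost : almost_flow T omega varpi delta 1 eta phi;
  stable_lip : forall T', 0 < T' -> T' <= T ->
    forall s t, 0 <= s -> s <= t -> t <= T' ->
    (lip_norm (phi t s) <= (1 + delta T')%:E)%E;
  stable_four_points :
    exists (phihat : R -> R -> R -> R) (phidag : R -> R -> R),
    [/\ forall s t, 0 <= s -> s <= t -> t <= T ->
          four_points_control (phi t s) (phihat t s) (phidag t s),
        forall T', 0 < T' -> T' <= T ->
          forall s t, 0 <= s -> s <= t -> t <= T' ->
          phidag t s <= 1 + delta T',
        forall u s t v, 0 <= u -> u <= s -> s <= t -> t <= v -> v <= T ->
          forall x, 0 <= x -> phihat t s x <= phihat v u x
      & forall s t, 0 <= s -> s <= t -> t <= T -> forall x, 0 <= x ->
          phihat t s (x * varpi (omega s t))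
            <= phistar x * varpi (omega s t)];
  stable_phistar_ge0 : forall x, 0 <= x -> 0 <= phistar x;
  stable_C'_ge0 : 0 <= C';
  stable_defect : forall r s t, 0 <= r -> r <= s -> s <= t -> t <= T ->
    (lip_norm (defect phi t s r) <= (C' * varpi (omega r t))%:E)%E }.

End setting.

(* Main.v *)
Require Import Defs.
From HB Require Import structures.
From mathcomp Require Import all_boot all_order all_algebra.
From mathcomp Require Import all_classical all_reals all_analysis.
From mathcomp Require Import ring lra.
Set Implicit Arguments.
Unset Strict Implicit.
Unset Printing Implicit Defensive.
Import Order.TTheory GRing.Theory Num.Theory.
Import numFieldNormedType.Exports.
Local Open Scope classical_set_scope.
Local Open Scope ring_scope.

(** Write [u s t] for the norm of
    [y t - phi t s (y s) - z t + zeta t s (z s)].  Replacing [phi t r] by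
    [phi t s \o phi s r] up to a defect, likewise for [zeta], and writing
    [zeta = phi + alpha], one sees that [u r t] exceeds [u s t] by at most the
    norm of a four-point difference of [phi t s], at the points [y s],
    [phi s r (y r)], [z s] and [zeta s r (z r)], plus errors of order
    [varpi (omega r t)].  The four-points control turns this into the
    almost additive inequality
<<
      u r t <= u s t + (1 + delta) * u r s + B * varpi (omega r t)
>>
    where [B] is linear in [eps1], [eps2], [eps3] and in a bound [D] on
    [`|y - z|] ([gap_splitting]).

    Such an inequality calls for a sewing argument: splitting
    [[r, t]] where [omega] is halved shows that any bound
    [u <= A * varpi omega] improves to [u <= (k * A + 3 * B) * varpi omega]
    with [k = (1 + varkappa) / 2 < 1], because
    [2 * varpi (tau / 2) <= varkappa * varpi tau].  Since [A = 2 * `|K|] is an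
    initial bound, the best constant is at most [3 * B / (1 - k)]
    ([davie_estimate], through [self_improving_bound]).

    It remains to remove [D].  Applied on [[0, t]], the estimate bounds
    [`|y t - z t|] by a multiple of [D * varpi (omega 0 T0)] plus a multiple
    of [eps1 + eps2 + eps3 + `|y 0 - z 0|].  For [T0] small the coefficient
    of [D] is at most [1 / 2], and [self_improving_bound] concludes again.
    How small [T0] must be depends on [omega] and [varpi]; the resulting
    constants do not, as smallness only enters through the inequalities
    [3 * delta T0 <= 1 - varkappa] and
    [varpi (omega 0 T0) <= (1 + 2 * c * q)^-1], with [c] and [q] built from
    [varkappa], [K], [phistar] and [C']. *)

(** * Bounds that improve themselves *)

(** The best constant [A] in [f <= A * g] is attained, so it satisfies
    [A <= k * A + b].  The initial bound matters: without it the set of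
    admissible constants could be empty and the step vacuous. *)
Lemma self_improving_bound (R : realType) (I : Type) (f g : I -> R) (k b : R) :
  0 <= k < 1 -> 0 <= b -> (forall i, 0 <= g i) ->
  (exists2 A, 0 <= A & forall i, f i <= A * g i) ->
  (forall A, 0 <= A -> (forall i, f i <= A * g i) ->
    forall i, f i <= (k * A + b) * g i) ->
  forall i, f i <= b / (1 - k) * g i.
Proof.
move=> /andP[k0 k1] b0 g0 [A0 A00 fA0] step.
pose S := [set A | 0 <= A /\ forall i, f i <= A * g i].
have hS : has_inf S by split; [exists A0 | exists 0 => A []].
have infS0 : 0 <= inf S by apply: lb_le_inf => [|A []//]; exists A0.
have infSf i : f i <= inf S * g i.
  have := g0 i; rewrite le_eqVlt => /predU1P[g0E|gi0].
    by have := fA0 i; rewrite -g0E !mulr0.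
  rewrite -ler_pdivrMr//; apply: lb_le_inf; first by exists A0.
  by move=> A [_ fA]; rewrite ler_pdivrMr.
have le_inf : inf S <= k * inf S + b.
  apply: ge_inf; first by exists 0 => A [].
  by split; [rewrite addr_ge0 ?mulr_ge0 | exact: step].
move=> i; apply: (le_trans (infSf i)); apply: ler_wpM2r => //.
by rewrite ler_pdivlMr ?subr_gt0//; lra.
Qed.

(** * Controls and remainders *)

Lemma control_le (R : realType) (T : R) (omega : R -> R -> R) :
  control T omega -> forall r s t v : R, 0 <= r -> r <= s -> s <= t -> t <= v ->
  v <= T -> omega s t <= omega r v.
Proof.
move=> ctrl r s t v r0 rs st tv vT.
have s0 := le_trans r0 rs; have t0 := le_trans s0 st.
have h1 := control_superadd ctrl r0 rs (le_trans st tv) vT.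
have h2 := control_superadd ctrl s0 st tv vT.
have h3 := control_ge0 ctrl r0 rs (le_trans st (le_trans tv vT)).
have h4 := control_ge0 ctrl t0 tv vT.
lra.
Qed.

Lemma control_small_diag (R : realType) (T : R) (omega : R -> R -> R) (u e : R) :
  control T omega -> 0 <= u -> u <= T -> 0 < e ->
  exists2 d, 0 < d & forall s t : R, 0 <= s -> s <= t -> t <= T ->
    `|u - s| < d -> `|u - t| < d -> omega s t < e.
Proof.
move=> ctrl u0 uT e0.
have := control_cont ctrl u0 uT; rewrite (control_diag ctrl u0 uT) => om.
have : nbhs (u, u) [set p | simplex T p -> omega p.1 p.2 < e].
  exact: (om _ (lt_nbhsl e0)).
move=> /nbhs_ballP[d /= d0 bd].
exists d => // s t s0 st tT us ut.
by apply: (bd (s, t)) => //; split.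
Qed.

(** Away from the diagonal [omega] may jump, so an interval need not have a
    point that halves its control.  At the supremum of the points [s] with
    [omega r s <= omega r t / 2], superadditivity halves the control on both
    sides up to an arbitrarily short interval around that point, and
    continuity at the diagonal makes the control of that interval small. *)
Lemma near_halving (R : realType) (T : R) (omega : R -> R -> R) (r t e : R) :
  control T omega -> 0 <= r -> r <= t -> t <= T -> 0 < e ->
  exists s1 s2, [/\ r <= s1, s1 <= s2, s2 <= t, omega r s1 <= omega r t / 2 &
    omega s2 t <= omega r t / 2 /\ omega s1 s2 < e].
Proof.
move=> ctrl r0 rt tT e0; have t0 := le_trans r0 rt.
have om0 : 0 <= omega r t by exact: control_ge0 ctrl _ _ _ _ _.
pose S := [set s | r <= s <= t /\ omega r s <= omega r t / 2].
have Sr : S r.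
  rewrite /S /= lexx rt (control_diag ctrl r0 (le_trans rt tT)).
  by split => //; rewrite divr_ge0.
have ubS : ubound S t by move=> s [/andP[]].
have hS : has_sup S by split; [exists r | exists t].
have ru : r <= sup S by apply: ub_le_sup => //; exists t.
have ut : sup S <= t by apply: ge_sup => //; exists r.
have [d d0 small] :=
  control_small_diag ctrl (le_trans r0 ru) (le_trans ut tT) e0.
have [s1 Ss1 us1] := sup_adherent d0 hS.
have s1u : s1 <= sup S by apply: ub_le_sup => //; exists t.
have [/andP[rs1 _] om1] := Ss1.
pose s2 := Num.min t (sup S + d / 2).
have us2 : sup S <= s2 by rewrite le_min ut lerDl divr_ge0// ltW.
have s2t : s2 <= t by rewrite ge_min lexx.
have s2d : s2 <= sup S + d / 2 by rewrite ge_min lexx orbT.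
have rs2 := le_trans ru us2.
exists s1, s2; split => //; first exact: le_trans us2.
split; last first.
  apply: small; [exact: le_trans rs1|exact: le_trans us2|exact: le_trans tT| |].
  - by rewrite ger0_norm; lra.
  - by rewrite ler0_norm; lra.
have [->|s2nt] := eqVneq s2 t.
  by rewrite (control_diag ctrl t0 tT) divr_ge0.
have s2E : s2 = sup S + d / 2.
  by move: s2nt; rewrite /s2; case: leP => //; rewrite eqxx.
have om2 : omega r t / 2 < omega r s2.
  rewrite ltNge; apply/negP => om2.
  have : s2 <= sup S by apply: ub_le_sup; [exists t|split; [rewrite rs2|]].
  by rewrite s2E; lra.
have := control_superadd ctrl r0 rs2 s2t tT; lra.
Qed.

Lemma remainder_small (R : realType) (Omega varkappa : R) (varpi : R -> R) h :
  remainder Omega varkappa varpi -> 0 <= Omega -> 0 < h ->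
  exists2 e, 0 < e & forall x, 0 <= x -> x <= Omega -> x < e -> varpi x < h.
Proof.
move=> rem Om0 h0.
have cont : varpi x @[x --> within `[0, Omega]%classic (nbhs 0)] --> varpi 0.
  move/subspace_continuousP : (remainder_cont rem); apply.
  by rewrite /= in_itv/= lexx.
rewrite (remainder0 rem) in cont.
have : nbhs (0 : R) [set x | `[0, Omega]%classic x -> varpi x < h].
  exact: (cont _ (lt_nbhsl h0)).
move=> /nbhs_ballP[e /= e0 be]; exists e => // x x0 xO xe.
apply: be; last by rewrite /= in_itv/= x0.
by rewrite /ball/= sub0r normrN ger0_norm.
Qed.

(** * The sewing estimate *)

(** Applying the almost additivity of [u] at the two points of [near_halving]
    bounds [u r t] by the two halves, which carry the factor [varkappa / 2]
    each, by a middle term as small as desired, and by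
    [(2 + d) * B * varpi (omega r t)].  The condition on [d] makes
    [varkappa / 2 * (1 + (1 + d) ^+ 2)] at most [(1 + varkappa) / 2 < 1], so
    that the bound on [u] improves itself. *)
Lemma davie_estimate (R : realType) (T T0 varkappa d B A0 : R)
    (omega : R -> R -> R) (varpi : R -> R) (u : R -> R -> R) :
  control T omega -> remainder (omega 0 T) varkappa varpi -> T0 <= T ->
  0 <= d -> 3 * d <= 1 - varkappa -> 0 <= B -> 0 <= A0 ->
  (forall s t : R, 0 <= s -> s <= t -> t <= T0 ->
    u s t <= A0 * varpi (omega s t)) ->
  (forall r s t : R, 0 <= r -> r <= s -> s <= t -> t <= T0 ->
    u r t <= u s t + (1 + d) * u r s + B * varpi (omega r t)) ->
  forall s t : R, 0 <= s -> s <= t -> t <= T0 ->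
    u s t <= 6 / (1 - varkappa) * B * varpi (omega s t).
Proof.
move=> ctrl rem T0T d0 d1 B0 A00 uA0 usub s t s0 st tT0.
have /andP[k0 k1] := remainder_varkappa rem.
have om_in (x y : R) : 0 <= x -> x <= y -> y <= T0 ->
    0 <= omega x y <= omega 0 T.
  move=> x0 xy yT0; rewrite (control_ge0 ctrl)// ?(le_trans yT0)//=.
  by apply: (control_le ctrl) => //; exact: le_trans T0T.
have mono (x y : R) : 0 <= x -> x <= y -> y <= omega 0 T -> varpi x <= varpi y.
  move=> x0 xy yO; apply: (remainder_incr rem) => //; rewrite in_itv/=.
    by rewrite x0 (le_trans xy).
  by rewrite yO (le_trans x0).
have varpi_ge0 (x : R) : 0 <= x <= omega 0 T -> 0 <= varpi x.
  by move=> xO; apply: (remainder_ge0 rem); rewrite in_itv.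
pose I := {p : R * R | simplex T0 p}.
pose f (p : I) := u (sval p).1 (sval p).2.
pose g (p : I) := varpi (omega (sval p).1 (sval p).2).
have -> : 6 / (1 - varkappa) * B = (3 * B) / (1 - (1 + varkappa) / 2).
  by field; lra.
have Ist : simplex T0 (s, t) by [].
apply: (@self_improving_bound R I f g ((1 + varkappa) / 2) (3 * B)
  _ _ _ _ _ (exist _ (s, t) Ist)).
- lra.
- by rewrite mulr_ge0.
- by move=> [[x y] [/= x0 [xy yT]]]; apply/varpi_ge0/om_in.
- by exists A0 => // -[[x y] [/= x0 [xy yT]]]; apply: uA0.
move=> A A_ge0 uA [[r v] [/= r0 [rv vT0]]]; rewrite /f /g /=.
have {}uA (x y : R) : 0 <= x -> x <= y -> y <= T0 -> u x y <= A * varpi (omega x y).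
  by move=> x0 xy yT; apply: (uA (exist _ (x, y) (conj x0 (conj xy yT)))).
have /andP[w0 wO] := om_in _ _ r0 rv vT0.
move: w0; rewrite le_eqVlt => /predU1P[w0|w0].
  by have := uA _ _ r0 rv vT0; rewrite -w0 (remainder0 rem) !mulr0.
apply/ler_addgt0Pr => e e0.
(* The middle term enters with a factor at most [2 * A]; adding 1 avoids a
   division by 0. *)
have h0 : 0 < e / (1 + 2 * A) by rewrite divr_gt0//; lra.
have [e' e'0 small] := remainder_small rem (le_trans (ltW w0) wO) h0.
have [s1 [s2 [rs1 s12 s2v half1 [half2 gap]]]] :=
  near_halving ctrl r0 rv (le_trans vT0 T0T) e'0.
have s10 := le_trans r0 rs1; have s20 := le_trans s10 s12.
have s2T0 := le_trans s2v vT0; have s1T0 := le_trans s12 s2T0.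
have half := remainder_half rem w0 wO.
have /andP[w1 _] := om_in _ _ r0 rs1 s1T0.
have /andP[w2 _] := om_in _ _ s20 s2v vT0.
have /andP[w12 w12'] := om_in _ _ s10 s12 s2T0.
have w2O : omega r v / 2 <= omega 0 T by lra.
have p1 := mono _ _ w1 half1 w2O.
have p2 := mono _ _ w2 half2 w2O.
have p12 := small _ w12 w12' gap.
have prs2 : varpi (omega r s2) <= varpi (omega r v).
  have /andP[rs2_ge0 _] := om_in _ _ r0 (le_trans rs1 s12) s2T0.
  apply: mono => //.
  exact: (control_le ctrl r0 (lexx r) (le_trans rs1 s12) s2v (le_trans vT0 T0T)).
have P0 : 0 <= varpi (omega r v) by apply: varpi_ge0; rewrite ltW.
have u1 := uA _ _ r0 rs1 s1T0.
have u2 := uA _ _ s20 s2v vT0.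
have u12 := uA _ _ s10 s12 s2T0.
have sub1 := usub _ _ _ r0 (le_trans rs1 s12) s2v vT0.
have sub2 := usub _ _ _ r0 rs1 s12 s2T0.
set P := varpi (omega r v) in half prs2 P0 sub1 *.
have Q : A * varpi (omega r v / 2) <= A * (varkappa * P / 2).
  by apply: ler_wpM2l => //; lra.
have {p1}u1 : u r s1 <= A * (varkappa * P / 2).
  by apply: le_trans u1 (le_trans _ Q); exact: ler_wpM2l.
have {p2}u2 : u s2 v <= A * (varkappa * P / 2).
  by apply: le_trans u2 (le_trans _ Q); exact: ler_wpM2l.
have {}u12 : 2 * u s1 s2 <= e.
  have : A * varpi (omega s1 s2) <= A * (e / (1 + 2 * A)).
    by apply: ler_wpM2l => //; exact: ltW.
  have : e / (1 + 2 * A) * (1 + 2 * A) = e by rewrite divfK//; apply/eqP; lra.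
  lra.
have d1' : d <= 1 by lra.
have sub2' : u r s2 <= e / 2 + (1 + d) * (A * (varkappa * P / 2)) + B * P.
  apply: le_trans sub2 _; apply: lerD; last exact: ler_wpM2l.
  by apply: lerD; [lra | apply: ler_wpM2l => //; lra].
have sub1' : (1 + d) * u r s2 <=
    (1 + d) * (e / 2 + (1 + d) * (A * (varkappa * P / 2)) + B * P).
  by apply: ler_wpM2l => //; lra.
have AP0 : 0 <= A * P by exact: mulr_ge0.
have BP0 : 0 <= B * P by exact: mulr_ge0.
have coef : (1 + (1 + d) * (1 + d)) * varkappa <= 1 + varkappa by nra.
have := ler_wpM2r AP0 coef.
have : d * (B * P) <= B * P by rewrite ler_piMl.
have : d * e <= e by rewrite ler_piMl// ltW.
move: sub1 sub1' u2; lra.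
Qed.

(** * The gap between the two almost flows *)

Lemma lip_normP (R : realType) (V : normedModType R) (f : V -> V) (c : R) :
  (lip_norm f <= c%:E)%E -> forall a b, `|f a - f b| <= c * `|a - b|.
Proof.
move=> fc a b; have [->|ab] := eqVneq a b; first by rewrite !subrr normr0 mulr0.
rewrite -ler_pdivrMr ?normr_gt0 ?subr_eq0// -lee_fin; apply: le_trans fc.
by apply: ereal_sup_ubound; exists (a, b).
Qed.

Lemma ler_norm_gap (R : numDomainType) (V : normedZmodType R) (a b c d : V) :
  `|a - b - c + d| <= `|a - b| + `|c - d|.
Proof.
by apply: le_trans (ler_normB (a - b) (c - d)); rewrite opprB addrA addrAC.
Qed.

(** The terms stand for [a = phi t s (y s)], [b = phi t s (phi s r (y r))],
    [c = phi t s (z s)], [d = phi t s (zeta s r (z r))],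
    [e = zeta t s (z s)], [g = zeta t s (zeta s r (z r))],
    [p = phi t r (y r)], [q = zeta t r (z r)],
    [m = phi t s (phi s r (z r))] and [n = phi t r (z r)].  On the right are
    the gap on [[s, t]], the four-point difference of [phi t s], the
    increment of [zeta t s - phi t s], the increment of the defect of [phi],
    and the difference of the two defects at [z r]. *)
Lemma defect_identity (V : zmodType) (yt zt a b c d e g p q m n : V) :
  yt - p - zt + q =
    (yt - a - zt + e) + (a - b - c + d) - ((e - c) - (g - d))
    + ((b - p) - (m - n)) - ((g - q) - (m - n)).
Proof.
have shift (u v w : V) : u - w - (v - w) = u - v.
  by rewrite opprB addrA addrNK.
rewrite -[RHS]addrA shift !opprB !addrA -[RHS]addr0 -!addrA.
(* Each pair of opposite terms is brought to the front and cancelled. *)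
rewrite ?(addrCA _ (- a)) ?(addrCA _ a) ?addKr ?addNKr.
rewrite ?(addrCA _ (- b)) ?(addrCA _ b) ?addKr ?addNKr.
rewrite ?(addrCA _ (- c)) ?(addrCA _ c) ?addKr ?addNKr.
rewrite ?(addrCA _ (- d)) ?(addrCA _ d) ?addKr ?addNKr.
rewrite ?(addrCA _ (- e)) ?(addrCA _ e) ?addKr ?addNKr.
rewrite ?(addrCA _ (- g)) ?(addrCA _ g) ?addKr ?addNKr.
by rewrite addr0 (addrCA (- p)).
Qed.

(** Almost additivity of the gap at a triple [r <= s <= t]: here [f], [f'],
    [h] are [phi t s], [phi s r], [phi t r], and the capital letters are the
    corresponding maps of [zeta].  The increments [X] of the paths over
    [[r, s]] are small, of order [varpi (omega r s)], whereas [N] measures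
    the distance between the two paths; the four-points control multiplies
    the two, whence the product [P * N]. *)
Lemma gap_splitting (R : realType) (V : normedModType R)
    (f f' h F F' H : V -> V) (fhat : R -> R) (fdag d e X P N Q1 Q2 : R)
    (yr ys yt zr zs zt : V) :
  four_points_control f fhat fdag -> fdag <= 1 + d -> 0 <= e ->
  fhat X <= P -> `|ys - f' yr| <= X -> `|zs - F' zr| <= X ->
  `|ys - zs| <= N -> `|f' yr - F' zr| <= N ->
  (forall a b, `|(F a - f a) - (F b - f b)| <= e * `|a - b|) ->
  `|(f (f' yr) - h yr) - (f (f' zr) - h zr)| <= Q1 ->
  `|(F (F' zr) - H zr) - (f (f' zr) - h zr)| <= Q2 ->
  `|yt - h yr - zt + H zr| <=
    `|yt - f ys - zt + F zs| + (1 + d) * `|ys - f' yr - zs + F' zr|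
      + (P * N + e * X + Q1 + Q2).
Proof.
move=> [fhat0 fhat_mono _ _ fpts] fdag_le e0 fhatX ysX zsX yzN fFN lipF le1 le2.
have X0 : 0 <= X by exact: le_trans ysX.
have four := fpts ys (f' yr) zs (F' zr).
have max_le : Num.max `|ys - f' yr| `|zs - F' zr| <= X by rewrite ge_max ysX.
have max0 : 0 <= Num.max `|ys - f' yr| `|zs - F' zr| by rewrite le_max normr_ge0.
have hat_le : fhat (Num.max `|ys - f' yr| `|zs - F' zr|) <= P.
  apply: le_trans fhatX; apply: fhat_mono => //; rewrite in_itv/= ?max0 ?X0//.
have N_le : Num.max `|ys - zs| `|f' yr - F' zr| <= N by rewrite ge_max yzN.
have bound1 : fhat (Num.max `|ys - f' yr| `|zs - F' zr|)
    * Num.max `|ys - zs| `|f' yr - F' zr| <= P * N.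
  apply: ler_pM => //.
  by apply: fhat0; rewrite in_itv/= max0.
have bound2 : fdag * `|ys - f' yr - zs + F' zr|
    <= (1 + d) * `|ys - f' yr - zs + F' zr| by exact: ler_wpM2r.
have bound3 : `|(F zs - f zs) - (F (F' zr) - f (F' zr))| <= e * X.
  by apply: le_trans (lipF _ _) _; exact: ler_wpM2l.
rewrite (defect_identity yt zt (f ys) (f (f' yr)) (f zs) (f (F' zr)) (F zs)
  (F (F' zr)) (h yr) (H zr) (f (f' zr)) (h zr)).
apply: le_trans (ler_normB _ _) _; apply: le_trans (lerD (ler_normD _ _) le2) _.
have := ler_normB ((yt - f ys - zt + F zs) + (f ys - f (f' yr) - f zs + f (F' zr)))
  ((F zs - f zs) - (F (F' zr) - f (F' zr))).
have := ler_normD (yt - f ys - zt + F zs) (f ys - f (f' yr) - f zs + f (F' zr)).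
lra.
Qed.

(** The sewing estimate for the gap, conditionally on a bound [D] of the
    distance between the paths.  The bound is linear in [D] with a
    coefficient that will be multiplied by the small number
    [varpi (omega 0 T0)], which is what allows [D] to be absorbed. *)
Lemma gap_bound (R : realType) (V : completeNormedModType R)
    (T T0 varkappa C' K D eps1 eps2 eps3 : R) (omega : R -> R -> R)
    (varpi delta eta phistar : R -> R) (phi zeta : R -> R -> V -> V)
    (y z : R -> V) :
  control T omega -> remainder (omega 0 T) varkappa varpi ->
  time_modulus delta ->
  stable_almost_flow T omega varpi delta eta phistar C' phi ->
  0 < T0 <= T -> 3 * delta T0 <= 1 - varkappa -> 0 <= K ->
  (forall s t : R, 0 <= s -> s <= t -> t <= T ->
    `|y t - phi t s (y s)| <= K * varpi (omega s t)) ->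
  (forall s t : R, 0 <= s -> s <= t -> t <= T ->
    `|z t - zeta t s (z s)| <= K * varpi (omega s t)) ->
  0 <= eps1 -> 0 <= eps2 -> 0 <= eps3 ->
  (forall r s t : R, 0 <= r -> r <= s -> s <= t -> t <= T ->
    [/\ `|defect zeta t s r (z r) - defect phi t s r (z r)|
          <= eps1 * varpi (omega r t),
        (lip_norm (fun a => zeta t s a - phi t s a)%R <= eps2%:E)%E
      & `|zeta t s (z s) - phi t s (z s)| <= eps3]) ->
  0 <= D -> (forall t : R, 0 <= t -> t <= T0 -> `|y t - z t| <= D) ->
  forall s t : R, 0 <= s -> s <= t -> t <= T0 ->
    `|y t - phi t s (y s) - z t + zeta t s (z s)| <=
      6 / (1 - varkappa)
      * (eps1 + K * eps2 + phistar K * (2 * D + eps3) + C' * D)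
      * varpi (omega s t).
Proof.
move=> ctrl rem dlt stab /andP[T00 T0T] d1 K0 yK zK e10 e20 e30 comp D0 yzD.
have /andP[k0 k1] := remainder_varkappa rem.
have d0 : 0 <= delta T0 by apply: (time_modulus_ge0 dlt); exact: ltW.
have ps0 := stable_phistar_ge0 stab K0; have C'0 := stable_C'_ge0 stab.
have [phihat [phidag [fpts dag_le hat_mono hat_le]]] := stable_four_points stab.
have varpi_mono (r s t v : R) : 0 <= r -> r <= s -> s <= t -> t <= v -> v <= T ->
    0 <= varpi (omega s t) <= varpi (omega r v).
  move=> r0 rs st tv vT; have s0 := le_trans r0 rs.
  have v0 := le_trans s0 (le_trans st tv).
  have st_le := control_le ctrl r0 rs st tv vT.
  have st_ge0 := control_ge0 ctrl s0 st (le_trans tv vT).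
  have rv_le := control_le ctrl (lexx 0) r0 (le_trans rs (le_trans st tv)) vT (lexx T).
  apply/andP; split.
    by apply: (remainder_ge0 rem); rewrite in_itv/= st_ge0 (le_trans st_le).
  by apply: (remainder_incr rem) => //; rewrite in_itv/=;
    rewrite ?st_ge0 ?(le_trans st_le)// (le_trans st_ge0).
apply: (davie_estimate (A0 := 2 * K) ctrl rem T0T d0 d1).
- by rewrite !addr_ge0 ?mulr_ge0 ?addr_ge0 ?mulr_ge0.
- by rewrite mulr_ge0.
- move=> s t s0 st tT0; have tT := le_trans tT0 T0T.
  apply: le_trans (ler_norm_gap _ _ _ _) _.
  have := yK _ _ s0 st tT; have := zK _ _ s0 st tT; lra.
move=> r s t r0 rs st tT0.
have s0 := le_trans r0 rs; have rt := le_trans rs st.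
have t0 := le_trans s0 st; have tT := le_trans tT0 T0T.
have sT0 := le_trans st tT0; have sT := le_trans st tT.
have rT0 := le_trans rs sT0.
have /andP[P0 P_rs] := varpi_mono _ _ _ _ r0 (lexx r) rs st tT.
have [comp1 comp2 _] := comp _ _ _ r0 rs st tT.
have [_ _ comp3] := comp _ _ _ r0 (lexx r) rs sT.
have -> : (eps1 + K * eps2 + phistar K * (2 * D + eps3) + C' * D) * varpi (omega r t)
    = phistar K * varpi (omega r t) * (2 * D + eps3)
      + eps2 * (K * varpi (omega r t)) + C' * varpi (omega r t) * D
      + eps1 * varpi (omega r t) by ring.
have KP : K * varpi (omega r s) <= K * varpi (omega r t) by exact: ler_wpM2l.
have yzr := yzD _ r0 rT0.
have dD : delta T0 * D <= D by rewrite ler_piMl//; lra.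
have almost_add := @gap_splitting R V (phi t s) (phi s r) (phi t r)
  (zeta t s) (zeta s r) (zeta t r) (phihat t s) (phidag t s) (delta T0) eps2
  (K * varpi (omega r t)) (phistar K * varpi (omega r t)) (2 * D + eps3)
  (C' * varpi (omega r t) * D) (eps1 * varpi (omega r t))
  (y r) (y s) (y t) (z r) (z s) (z t) (fpts _ _ s0 st tT)
  (dag_le _ T00 T0T _ _ s0 st tT0) e20.
apply: almost_add => //.
- (* [phistar] controls [phihat t r] only at multiples of
     [varpi (omega r t)], hence the passage to the larger interval. *)
  apply: le_trans (hat_le _ _ r0 rt tT _ K0).
  apply: hat_mono => //; rewrite mulr_ge0//.
  by have /andP[] := varpi_mono _ _ _ _ r0 (lexx r) rt (lexx t) tT.
- exact: le_trans (yK _ _ r0 rs sT) KP.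
- exact: le_trans (zK _ _ r0 rs sT) KP.
- by apply: le_trans (yzD _ s0 sT0) _; lra.
- apply: le_trans (ler_distD (phi s r (z r)) _ _) _.
  have lip := lip_normP (stable_lip stab T00 T0T r0 rs sT0) (y r) (z r).
  have lipD : (1 + delta T0) * `|y r - z r| <= (1 + delta T0) * D.
    by apply: ler_wpM2l => //; lra.
  rewrite distrC in comp3; lra.
- exact: lip_normP.
- apply: le_trans (lip_normP (stable_defect stab r0 rs st tT) _ _) _.
  apply: ler_wpM2l => //; rewrite mulr_ge0//.
  by have /andP[] := varpi_mono _ _ _ _ r0 (lexx r) rt (lexx t) tT.
Qed.

Theorem proposition12 (R : realType) (V : completeNormedModType R)
    (phi : R -> R -> V -> V) (phistar : R -> R) (K : R) (delta : R -> R)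
    (varkappa C' : R) :
  exists C : R,
  forall (T : R) (omega : R -> R -> R) (varpi eta : R -> R),
    0 < T ->
    control T omega ->
    remainder (omega 0 T) varkappa varpi ->
    time_modulus delta ->
    holder_term T omega varpi delta 1 eta ->
    stable_almost_flow T omega varpi delta eta phistar C' phi ->
  exists2 T0 : R, 0 < T0 <= T &
  forall (delta' : R -> R) (gamma' : R) (eta' : R -> R)
    (zeta : R -> R -> V -> V) (y z : R -> V) (eps1 eps2 eps3 : R),
    time_modulus delta' ->
    holder_term T omega varpi delta' gamma' eta' ->
    almost_flow T omega varpi delta' gamma' eta' zeta ->
    (forall s t, 0 <= s -> s <= t -> t <= T ->
      `|y t - phi t s (y s)| <= K * varpi (omega s t)) ->
    (forall s t, 0 <= s -> s <= t -> t <= T ->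
      `|z t - zeta t s (z s)| <= K * varpi (omega s t)) ->
    0 < eps1 -> 0 < eps2 -> 0 < eps3 ->
    (forall r s t, 0 <= r -> r <= s -> s <= t -> t <= T ->
      [/\ `|defect zeta t s r (z r) - defect phi t s r (z r)|
            <= eps1 * varpi (omega r t),
          (lip_norm (fun a => zeta t s a - phi t s a)%R <= eps2%:E)%E
        & `|zeta t s (z s) - phi t s (z s)| <= eps3]) ->
    forall s t, 0 <= s -> s <= t -> t <= T0 ->
      `|y t - z t| <= C * (eps1 + eps2 + eps3 + `|y 0 - z 0|) /\
      `|y t - phi t s (y s) - z t + zeta t s (z s)|
        <= C * (eps1 + eps2 + eps3 + `|y 0 - z 0|) * varpi (omega s t).
Proof.
(* [c] is the constant of the sewing estimate; the gap is at most
   [c * (m * E + q * D) * varpi omega], where [E] is the total error and [D]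
   bounds the distance of the paths; absorbing half of [D] gives
   [D <= C0 * E]. *)
pose c := 6 / (1 - varkappa); pose m := 1 + `|K| + phistar `|K|.
pose q := 2 * phistar `|K| + C'; pose C0 := 2 * (c * m + 2).
exists (C0 + c * (m + q * C0)).
move=> T omega varpi eta T_gt0 ctrl rem dlt _ stab.
have /andP[k0 k1] := remainder_varkappa rem.
have ps0 := stable_phistar_ge0 stab (normr_ge0 K).
have C'0 := stable_C'_ge0 stab.
have c0 : 0 <= c by rewrite divr_ge0//; lra.
have K0 := normr_ge0 K.
have m1 : 1 <= m by rewrite /m; lra.
have q0 : 0 <= q by rewrite /q; lra.
have cm0 : 0 <= c * m by rewrite mulr_ge0//; lra.
have cq0 : 0 <= c * q by exact: mulr_ge0.
pose h := (1 + 2 * (c * q))^-1.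
have h0 : 0 < h by rewrite invr_gt0; lra.
have h1 : h <= 1 by rewrite invf_le1; lra.
have cqh : 2 * (c * q) * h <= 1.
  have : (1 + 2 * (c * q)) * h = 1 by rewrite mulfV//; apply/eqP; lra.
  lra.
have Omega0 := control_ge0 ctrl (lexx 0) (ltW T_gt0) (lexx T).
have [e e0 small] := remainder_small rem Omega0 h0.
have [d1 d10 smallom] := control_small_diag ctrl (lexx 0) (ltW T_gt0) e0.
have [d2 d20 smalldelta] : exists2 d2, 0 < d2 &
    forall x : R, 0 < x -> x < d2 -> delta x < (1 - varkappa) / 3.
  have k3 : 0 < (1 - varkappa) / 3 by rewrite divr_gt0//; lra.
  have : nbhs (0 : R) [set x : R | 0 < x -> delta x < (1 - varkappa) / 3].
    exact: (time_modulus_lim dlt (lt_nbhsl k3)).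
  move=> /nbhs_ballP[d2 /= d20 bd]; exists d2 => // x x0 xd.
  by apply: bd => //; rewrite /ball/= sub0r normrN gtr0_norm.
pose T0 := Num.min T (Num.min (d1 / 2) (d2 / 2)).
have T00 : 0 < T0 by rewrite !lt_min T_gt0 !divr_gt0.
have T0T : T0 <= T by rewrite ge_min lexx.
have T0d1 : T0 <= d1 / 2 by rewrite !ge_min lexx !orbT.
have T0d2 : T0 <= d2 / 2 by rewrite !ge_min lexx !orbT.
have T0_dom : 0 < T0 <= T by rewrite T00.
exists T0 => // delta' gamma' eta' zeta y z eps1 eps2 eps3 _ _ _ yK zK
  e10 e20 e30 comp.
have dT0 : 3 * delta T0 <= 1 - varkappa.
  have : delta T0 < (1 - varkappa) / 3 by apply: smalldelta => //; lra.
  lra.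
have d0 : 0 <= delta T0 by apply: (time_modulus_ge0 dlt); exact: ltW.
have om_le (s t : R) : 0 <= s -> s <= t -> t <= T -> omega s t <= omega 0 T.
  by move=> s0 st tT; apply: (control_le ctrl) => //; exact: le_trans st.
have varpi0 (s t : R) : 0 <= s -> s <= t -> t <= T -> 0 <= varpi (omega s t).
  move=> s0 st tT; apply: (remainder_ge0 rem); rewrite in_itv/= om_le//.
  by rewrite (control_ge0 ctrl).
have varpi_h (t : R) : 0 <= t -> t <= T0 -> varpi (omega 0 t) <= h.
  move=> t0 tT0; have tT := le_trans tT0 T0T.
  apply/ltW/small; [exact: (control_ge0 ctrl)|exact: om_le|].
  by apply: smallom => //; rewrite sub0r normrN ger0_norm//; lra.
(* [K] may be negative when [varpi] vanishes. *)
have le_absK (s t : R) : 0 <= s -> s <= t -> t <= T ->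
    K * varpi (omega s t) <= `|K| * varpi (omega s t).
  by move=> s0 st tT; rewrite ler_wpM2r ?ler_norm// varpi0.
have {}yK (s t : R) : 0 <= s -> s <= t -> t <= T ->
    `|y t - phi t s (y s)| <= `|K| * varpi (omega s t).
  by move=> s0 st tT; apply: le_trans (yK _ _ s0 st tT) _; exact: le_absK.
have {}zK (s t : R) : 0 <= s -> s <= t -> t <= T ->
    `|z t - zeta t s (z s)| <= `|K| * varpi (omega s t).
  by move=> s0 st tT; apply: le_trans (zK _ _ s0 st tT) _; exact: le_absK.
set E := eps1 + eps2 + eps3 + `|y 0 - z 0|.
have yz0 := normr_ge0 (y 0 - z 0).
have E0 : 0 <= E by rewrite /E; lra.
have gap D : 0 <= D -> (forall t : R, 0 <= t -> t <= T0 -> `|y t - z t| <= D) ->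
    forall s t : R, 0 <= s -> s <= t -> t <= T0 ->
    `|y t - phi t s (y s) - z t + zeta t s (z s)|
      <= c * (m * E + q * D) * varpi (omega s t).
  move=> D0 yzD s t s0 st tT0.
  apply: le_trans (gap_bound ctrl rem dlt stab T0_dom dT0 K0 yK zK
    (ltW e10) (ltW e20) (ltW e30) comp D0 yzD s0 st tT0) _.
  apply: ler_wpM2r; first by rewrite varpi0// (le_trans tT0).
  apply: ler_wpM2l => //; rewrite /m /q /E.
  have p1 := mulr_ge0 K0 (ltW e10); have p3 := mulr_ge0 K0 (ltW e30).
  have p4 := mulr_ge0 K0 yz0; have p5 := mulr_ge0 ps0 (ltW e10).
  have p6 := mulr_ge0 ps0 (ltW e20); have p7 := mulr_ge0 ps0 yz0.
  lra.
have dist_le (t : R) : 0 <= t -> t <= T0 ->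
    `|y t - z t| <= `|y t - phi t 0 (y 0) - z t + zeta t 0 (z 0)| + 2 * E.
  move=> t0 tT0; have tT := le_trans tT0 T0T.
  have -> : y t - z t = (y t - phi t 0 (y 0) - z t + zeta t 0 (z 0))
      + (phi t 0 (y 0) - zeta t 0 (z 0)).
    by rewrite [phi t 0 (y 0) - _]addrC addrA addrK addrAC subrK.
  apply: le_trans (ler_normD _ _) _; rewrite lerD2l.
  apply: le_trans (ler_distD (phi t 0 (z 0)) _ _) _.
  have lip := lip_normP (stable_lip stab T00 T0T (lexx 0) t0 tT0) (y 0) (z 0).
  have [_ _ comp3] := comp _ _ _ (lexx 0) (lexx 0) t0 tT.
  have : delta T0 * `|y 0 - z 0| <= `|y 0 - z 0| by rewrite ler_piMl//; lra.
  rewrite distrC in comp3; rewrite /E; lra.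
have yzC0 (t : R) : 0 <= t -> t <= T0 -> `|y t - z t| <= C0 * E.
  pose I := {t : R | 0 <= t <= T0}.
  pose f (i : I) := `|y (sval i) - z (sval i)|.
  move=> t0 tT0; have tI : 0 <= t <= T0 by rewrite t0.
  have -> : C0 * E = (c * m + 2) * E / (1 - 1 / 2) * 1 by rewrite /C0; field.
  apply: (@self_improving_bound R I f (fun=> 1) (1 / 2) ((c * m + 2) * E)
    _ _ _ _ _ (exist _ t tI)) => //.
  - lra.
  - by rewrite mulr_ge0//; lra.
  - (* The a priori bound, far from the claim but finite: the gap is at most
       [2 * `|K| * varpi omega]. *)
    exists (2 * `|K| * h + 2 * E) => [|[x xI]].
      by rewrite addr_ge0// !mulr_ge0// ltW.
    have /andP[x0 xT0] := xI; rewrite /f /= mulr1.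
    apply: le_trans (dist_le _ x0 xT0) _; rewrite lerD2r.
    have xT := le_trans xT0 T0T.
    have h_le : `|K| * varpi (omega 0 x) <= `|K| * h.
      by apply: ler_wpM2l => //; exact: varpi_h.
    apply: le_trans (ler_norm_gap _ _ _ _) _.
    have := yK _ _ (lexx 0) x0 xT; have := zK _ _ (lexx 0) x0 xT; lra.
  move=> D D0 fD [x xI]; have /andP[x0 xT0] := xI; rewrite /f /= mulr1.
  have yzD (v : R) : 0 <= v -> v <= T0 -> `|y v - z v| <= D.
    by move=> v0 vT0; have := fD (exist _ v (introT andP (conj v0 vT0)));
      rewrite /f /= mulr1.
  apply: le_trans (dist_le _ x0 xT0) _.
  have g1 := gap _ D0 yzD _ _ (lexx 0) x0 xT0.
  have g2 : c * (m * E + q * D) * varpi (omega 0 x) <= c * (m * E + q * D) * h.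
    apply: ler_wpM2l; last exact: varpi_h.
    by rewrite mulr_ge0// addr_ge0// mulr_ge0//; lra.
  have g3 := ler_wpM2r D0 cqh.
  have g4 : c * m * E * h <= c * m * E by rewrite ler_piMr// mulr_ge0.
  lra.
move=> s t s0 st tT0; have t0 := le_trans s0 st.
have qC0 : 0 <= c * (m + q * C0).
  by rewrite mulr_ge0// addr_ge0 ?mulr_ge0//; lra.
have C00 : 0 <= C0 by rewrite /C0; lra.
split.
  apply: le_trans (yzC0 _ t0 tT0) _; rewrite mulrDl lerDl; exact: mulr_ge0.
apply: le_trans (gap _ (mulr_ge0 C00 E0) yzC0 _ _ s0 st tT0) _.
apply: ler_wpM2r; first by rewrite varpi0// (le_trans tT0).
have := mulr_ge0 C00 E0; lra.
Qed.
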